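(* Let $\Theta\subset\mathbb{R}^d$ be closed, bounded and convex, let $\ell_t=f_t+r$ be convex Lipschitz losses, and let the standing assumptions listed in the context hold. Let $\mathcal{A}\subset\mathbb{R}^n$ be closed, bounded and convex, and let $\Phi_t:\Theta\times\mathcal{A}\to\Theta$, $t=1,\dots,T$, be a parametric family of dynamical models. Let $\varepsilon_N>0$ and let $\mathcal{A}_N\subset\mathcal{A}$ be a covering set of cardinality $N\ge2$, i.e. for every $\alpha\in\mathcal{A}$ there is $\alpha'\in\mathcal{A}_N$ with $\|\alpha-\alpha'\|\le\varepsilon_N$. Assume that the candidate models $\Phi_t(\cdot,\alpha)$, $\alpha\in\mathcal{A}_N$, are all contractive with respect to the Bregman divergence $D$: $D(\Phi_t(\theta,\alpha)\|\Phi_t(\theta',\alpha))\le D(\theta\|\theta')$ for all $\theta,\theta'\in\Theta$, all $t$. Assume also that for some $L>0$, $\|\Phi_t(\theta,\alpha)-\Phi_t(\theta,\beta)\|\le L\|\alpha-\beta\|$ for all $\theta\in\Theta$, $\alpha,\beta\in\mathcal{A}$ and all $t$. Then there is a constant $C>0$, independent of $T$, $N$ and $\varepsilon_N$, such that the Dynamic Fixed Share (DFS) algorithm (see context), run on the $N$ candidate models $\{\Phi_t(\cdot,\alpha)\}_{\alpha\in\mathcal{A}_N}$ with $\eta_t=\frac1{\sqrt t}$, $\eta_r=\sqrt{\frac{2\log N}{T}}$ and $\lambda=0$, satisfies for every comparator sequence $\boldsymbol\theta_T=(\theta_1,\dots,\theta_T)\in\Theta^T$ $$\sum_{t=1}^T\ell_t(\widehat\theta_t)-\sum_{t=1}^T\ell_t(\theta_t)\le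 C\sqrt T\left[\sqrt{\log N}+\min_{\alpha\in\mathcal{A}}V_\Phi(\boldsymbol\theta_T,\alpha)+T\varepsilon_N\right],$$ where $V_\Phi(\boldsymbol\theta_T,\alpha):=\sum_{t=1}^{T-1}\|\theta_{t+1}-\Phi_t(\theta_t,\alpha)\|$.
   Context: Setting. $\Theta\subset\mathbb{R}^d$ is closed, bounded, convex. At each time $t$ the loss is $\ell_t=f_t+r$, with $f_t,r:\Theta\to\mathbb{R}$ convex and $r$ not depending on $t$. Subgradients exist at all points of $\Theta$; $\nabla f_t(\theta),\nabla r(\theta)$ denote (arbitrarily chosen) subgradients and $\nabla\ell_t=\nabla f_t+\nabla r$. Standing assumptions. $\|\cdot\|$ is a norm on $\mathbb{R}^d$ with dual norm $\|\cdot\|_*$ (the same symbol $\|\cdot\|$ also denotes a fixed norm on $\mathbb{R}^n$ for parameters $\alpha$). $\psi:\Theta\to\mathbb{R}$ is continuously differentiable and $\sigma$-strongly convex ($\sigma>0$) with respect to $\|\cdot\|$: $\psi(\theta_1)\ge\psi(\theta_2)+\langle\nabla\psi(\theta_2),\theta_1-\theta_2\rangle+\frac\sigma2\|\theta_1-\theta_2\|^2$. The Bregman divergence is $D(\theta_1\|\theta_2)=\psi(\theta_1)-\psi(\theta_2)-\langle\nabla\psi(\theta_2),\theta_1-\theta_2\rangle$. For all $t$ and $\theta\in\Theta$: $\|\nabla\ell_t(\theta)\|_*\le G$ and $\|\nabla\psi(\theta)\|_*\le M$. For all $\theta_1,\theta_2\in\Theta$: $D(\theta_1\|\theta_2)\le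 D_{\max}$. The constants $\sigma,G,M,D_{\max},L$ do not depend on $T$. DFS algorithm on models $\Phi_{i,t}:\Theta\to\Theta$, $i=1,\dots,N$ (here $\Phi_{i,t}=\Phi_t(\cdot,\alpha_i)$ where $\mathcal{A}_N=\{\alpha_1,\dots,\alpha_N\}$). Parameters: step sizes $\eta_t>0$, $\eta_r>0$, and $\lambda\in[0,1)$. Initialize $\widehat\theta_1\in\Theta$, $\widehat\theta_{i,1}\in\Theta$, $w_{i,1}=1/N$ for $i=1,\dots,N$. For $t=1,\dots,T$: the loss $\ell_t(\widehat\theta_t)$ is incurred, and for each $i$ set $$\widetilde w_{i,t+1}=\frac{w_{i,t}\exp(-\eta_r\ell_t(\widehat\theta_{i,t}))}{\sum_{j=1}^N w_{j,t}\exp(-\eta_r\ell_t(\widehat\theta_{j,t}))},\qquad w_{i,t+1}=\frac\lambda N+(1-\lambda)\widetilde w_{i,t+1},$$ $$\widetilde\theta_{i,t+1}=\arg\min_{\theta\in\Theta}\ \eta_t\langle\nabla f_t(\widehat\theta_{i,t}),\theta\rangle+\eta_t r(\theta)+D(\theta\|\widehat\theta_{i,t}),\qquad \widehat\theta_{i,t+1}=\Phi_{i,t}(\widetilde\theta_{i,t+1});$$ then $\widehat\theta_{t+1}=\sum_{i=1}^N w_{i,t+1}\widehat\theta_{i,t+1}$. *)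

(* Defs.v *)
From HB Require Import structures.
From mathcomp Require Export all_boot all_order all_algebra.
From mathcomp Require Export all_classical all_reals all_analysis.

Set Implicit Arguments.
Unset Strict Implicit.
Unset Printing Implicit Defensive.

Import Order.TTheory GRing.Theory Num.Theory.
Import numFieldNormedType.Exports.

Local Open Scope classical_set_scope.
Local Open Scope ring_scope.

Section Euclidean.
Variables (R : realType) (d : nat).
Implicit Types (N : 'rV[R]_d -> R) (A : set 'rV[R]_d) (x y : 'rV[R]_d).

(* An arbitrary norm on R^d is a function N with this property; the library
   norm `|x| on 'rV[R]_d is the sup norm and only serves as a source for the
   usual topology. *)
Record is_norm N : Prop := IsNorm {
  is_norm_triangle : forall x y, N (x + y) <= N x + N y;
  is_norm_scale : forall a x, N (a *: x) = `|a| * N x;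
  is_norm_definite : forall x, N x = 0 -> x = 0 }.

Definition dot x y : R := \sum_(i < d) x 0 i * y 0 i.

(* The supremum is finite, since N is equivalent to the sup norm. *)
Definition dual_norm N x : R := sup [set dot x y | y in [set y | N y <= 1]].

Definition argmin A (F : 'rV[R]_d -> R) : set 'rV[R]_d :=
  [set x | A x /\ forall y, A y -> F x <= F y].

(* g selects one subgradient of f, relative to A, at each point of A. *)
Definition subgradient_on A (f : 'rV[R]_d -> R) (g : 'rV[R]_d -> 'rV[R]_d) :=
  forall x y, A x -> A y -> f x + dot (g x) (y - x) <= f y.

(* Differentiability is relative to A, so psi only matters on A, and A may have
   empty interior (g is then not determined by psi and is part of the data). *)
Definition C1_on A (psi : 'rV[R]_d -> R) (g : 'rV[R]_d -> 'rV[R]_d) :=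
  (forall x, A x -> forall e, 0 < e -> \forall y \near within A (nbhs x),
     `|psi y - psi x - dot (g x) (y - x)| <= e * `|y - x|) /\
  {within A, continuous g}.

Definition strongly_convex_on N A (sigma : R) (psi : 'rV[R]_d -> R)
    (gpsi : 'rV[R]_d -> 'rV[R]_d) :=
  forall x y, A x -> A y ->
    psi y + dot (gpsi y) (x - y) + sigma / 2 * N (x - y) ^+ 2 <= psi x.

Definition bregman (psi : 'rV[R]_d -> R) (gpsi : 'rV[R]_d -> 'rV[R]_d) x y : R :=
  psi x - psi y - dot (gpsi y) (x - y).

Definition contractive_on A (D : 'rV[R]_d -> 'rV[R]_d -> R)
    (Phi : 'rV[R]_d -> 'rV[R]_d) :=
  forall x y, A x -> A y -> D (Phi x) (Phi y) <= D x y.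

End Euclidean.

Section DFS.
Variables (R : realType) (d K T : nat) (Theta : set 'rV[R]_d).
Variable D : 'rV[R]_d -> 'rV[R]_d -> R.
Variables (f : nat -> 'rV[R]_d -> R) (r : 'rV[R]_d -> R).
Variable gf : nat -> 'rV[R]_d -> 'rV[R]_d.
Variable Phi : 'I_K -> nat -> 'rV[R]_d -> 'rV[R]_d.
Variables (eta : nat -> R) (eta_r lambda : R).

(* Rounds are t = 1, ..., T; indices outside 1, ..., T + 1 carry junk values.
   The quantities produced in round t are stored at index t + 1. *)
Record dfs_trajectory : Type := DfsTrajectory {
  forecast : nat -> 'rV[R]_d;
  expert : 'I_K -> nat -> 'rV[R]_d;
  expert_pre : 'I_K -> nat -> 'rV[R]_d;
  weight : 'I_K -> nat -> R;
  weight_pre : 'I_K -> nat -> R }.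

Record is_dfs (s : dfs_trajectory) : Prop := IsDfs {
  dfs_forecast1 : Theta (forecast s 1);
  dfs_expert1 : forall i, Theta (expert s i 1);
  dfs_weight1 : forall i, weight s i 1 = K%:R^-1;
  dfs_weight_pre : forall i t, (1 <= t <= T)%N ->
    weight_pre s i t.+1 =
      weight s i t * expR (- eta_r * (f t (expert s i t) + r (expert s i t))) /
      \sum_(j < K)
        weight s j t * expR (- eta_r * (f t (expert s j t) + r (expert s j t)));
  dfs_weight : forall i t, (1 <= t <= T)%N ->
    weight s i t.+1 = lambda / K%:R + (1 - lambda) * weight_pre s i t.+1;
  dfs_expert_pre : forall i t, (1 <= t <= T)%N ->
    argmin Theta
      (fun x => eta t * dot (gf t (expert s i t)) x + eta t * r x
                + D x (expert s i t))
      (expert_pre s i t.+1);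
  dfs_expert : forall i t, (1 <= t <= T)%N ->
    expert s i t.+1 = Phi i t (expert_pre s i t.+1);
  dfs_forecast : forall t, (1 <= t <= T)%N ->
    forecast s t.+1 = \sum_(i < K) weight s i t.+1 *: expert s i t.+1 }.

End DFS.

Definition variation (R : realType) (d n : nat) (N : 'rV[R]_d -> R) (T : nat)
    (Phi : nat -> 'rV[R]_d -> 'rV[R]_n -> 'rV[R]_d)
    (theta : nat -> 'rV[R]_d) (alpha : 'rV[R]_n) : R :=
  \sum_(1 <= t < T) N (theta t.+1 - Phi t (theta t) alpha).

(* Main.v *)
(* The regret splits into aggregation (forecast against one expert i) and
   tracking (expert i against the comparator).

   Aggregation: strong convexity and D <= Dmax bound the diameter of Theta, hence
   the oscillation of every loss on Theta by B = |G| sqrt (2 |Dmax| / sigma).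
   With lambda = 0 the weights are exponential weights, and
   e^(-x) <= 1 - x + x^2 bounds each normalizer, so that the weight of expert i,
   which is at most 1, is at least
   e^(eta_r * regret - T (2 eta_r B)^2) / N. The first forecast is arbitrary in
   Theta and costs one additional B.

   Tracking: the optimality condition of the proximal step gives a bound by
   sqrt t * (D(theta_t, x_t) - D(theta_t, x'_{t+1})) + O(1 / sqrt t), where x_t
   is expert i and x'_{t+1} its intermediate point; contractivity of the model
   gives D(theta_{t+1}, x_{t+1}) <= D(theta_t, x'_{t+1})
   + 2 M |theta_{t+1} - Phi_t(theta_t)|, and the sum telescopes.

   Taking for i a cover element close to a minimizer a of the variation costs
   T L eps; additive constants are absorbed by sqrt (ln N) >= 1 / 2. *)

Require Import Defs.
From mathcomp Require Import ring lra.

Set Implicit Arguments.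
Unset Strict Implicit.
Unset Printing Implicit Defensive.

Import Order.TTheory GRing.Theory Num.Theory.
Import numFieldNormedType.Exports.

Local Open Scope classical_set_scope.
Local Open Scope ring_scope.

(** * Norms and dual norms *)

Section Dot.
Variables (R : realType) (d : nat).
Implicit Types (x y z : 'rV[R]_d).

Lemma coord_le_norm x i : `|x 0 i| <= `|x|.
Proof.
rewrite [leRHS]/Num.Def.normr/= mx_normrE.
by apply/bigmax_geP; right => /=; exists (0, i).
Qed.

Lemma dotC x y : dot x y = dot y x.
Proof. by apply: eq_bigr => i _; rewrite mulrC. Qed.

Lemma dotDr x y z : dot x (y + z) = dot x y + dot x z.
Proof. by rewrite -big_split; apply: eq_bigr => i _; rewrite mxE mulrDr. Qed.

Lemma dotZr a x y : dot x (a *: y) = a * dot x y.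
Proof. by rewrite /dot mulr_sumr; apply: eq_bigr => i _; rewrite mxE mulrCA. Qed.

Lemma dotNr x y : dot x (- y) = - dot x y.
Proof. by rewrite -scaleN1r dotZr mulN1r. Qed.

Lemma dotBr x y z : dot x (y - z) = dot x y - dot x z.
Proof. by rewrite dotDr dotNr. Qed.

Lemma dot0r x : dot x 0 = 0.
Proof. by rewrite -(scale0r (0 : 'rV[R]_d)) dotZr mul0r. Qed.

Lemma dotDl x y z : dot (x + y) z = dot x z + dot y z.
Proof. by rewrite dotC dotDr !(dotC z). Qed.

Lemma dotBl x y z : dot (x - y) z = dot x z - dot y z.
Proof. by rewrite dotC dotBr !(dotC z). Qed.

End Dot.

Section NormedRow.
Variables (R : realType) (d : nat) (N : 'rV[R]_d -> R).
Hypothesis normN : is_norm N.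
Implicit Types (x y g : 'rV[R]_d).

Lemma is_norm0 : N 0 = 0.
Proof. by rewrite -(scale0r (0 : 'rV[R]_d)) (is_norm_scale normN) normr0 mul0r. Qed.

Lemma is_normN x : N (- x) = N x.
Proof. by rewrite -scaleN1r (is_norm_scale normN) normrN1 mul1r. Qed.

Lemma is_norm_ge0 x : 0 <= N x.
Proof.
have := is_norm_triangle normN x (- x).
by rewrite subrr is_norm0 is_normN -mulr2n pmulrn_lge0.
Qed.

Lemma is_norm_sum I (s : seq I) (F : I -> 'rV[R]_d) :
  N (\sum_(i <- s) F i) <= \sum_(i <- s) N (F i).
Proof.
elim/big_ind2 : _ => //; first by rewrite is_norm0.
move=> x a y b xa yb; apply: le_trans (is_norm_triangle normN _ _) _.
exact: lerD.
Qed.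

(** Expansion in the standard basis bounds [N x] by the sum of the [N] of the basis vectors; the
    extra 1 makes the constant positive even when [d = 0]. *)
Lemma is_norm_le_sup : exists2 c, 0 < c & forall x, N x <= c * `|x|.
Proof.
exists (1 + \sum_i N (delta_mx 0 i)).
  by rewrite ltr_pwDl ?sumr_ge0// => i _; exact: is_norm_ge0.
move=> x; rewrite [in leLHS](row_sum_delta x).
apply: le_trans (is_norm_sum _ _) _.
rewrite mulrDl mul1r -[leLHS]add0r lerD// mulr_suml ler_sum// => i _.
rewrite (is_norm_scale normN) mulrC ler_wpM2l ?is_norm_ge0//.
exact: coord_le_norm.
Qed.

Lemma is_norm_sub_le x y : `|N x - N y| <= N (x - y).
Proof.
rewrite ler_norml; apply/andP; split.
  rewrite lerNl opprB lerBlDr -(is_normN (x - y)) opprB.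
  by rewrite -[in leLHS](subrK x y) (is_norm_triangle normN).
by rewrite lerBlDr -[in leLHS](subrK y x) (is_norm_triangle normN).
Qed.

(** Transfers Lipschitz bounds in an arbitrary norm to the sup-norm topology, so that the extreme
    value theorem applies, first to [N] itself and later to the variation as a function of the
    parameter. *)
Lemma is_norm_lipschitz_continuous (A : set 'rV[R]_d) (F : 'rV[R]_d -> R) (c : R) :
  0 <= c -> (forall x y, A x -> A y -> `|F x - F y| <= c * N (x - y)) ->
  {within A, continuous F}.
Proof.
move=> c0 FL; have [k k0 Nk] := is_norm_le_sup.
have ck0 : 0 < c * k + 1 by rewrite ltr_wpDl// mulr_ge0// ltW.
apply/subspace_continuousP => x Ax; apply/cvgrPdist_le => /= e e0.
rewrite near_withinE.
have := nbhsx_ballx x _ (divr_gt0 e0 ck0); apply: filterS => y.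
rewrite -ball_normE /= => /ltW xy Ay.
apply: le_trans (FL _ _ Ax Ay) _.
apply: (@le_trans _ _ ((c * k + 1) * `|x - y|)).
  by rewrite mulrDl mul1r -mulrA -[leLHS]addr0 lerD// ler_wpM2l.
by rewrite mulrC -ler_pdivlMr.
Qed.

(** On the compact sup-norm sphere [N] attains a minimum, positive by definiteness; homogeneity
    extends the bound to all vectors. *)
Lemma sup_le_is_norm : exists2 c, 0 < c & forall x, c * `|x| <= N x.
Proof.
pose S := [set x : 'rV[R]_d | `|x| = 1].
have unit_S x : x != 0 -> S (`|x|^-1 *: x).
  by move=> x0; rewrite /S/= normrZ normfV normr_id mulVf// normr_eq0.
(* An empty sphere means that 0 is the only vector, so any constant works. *)
have [S0|/nonemptyPn S0] := pselect (S !=set0); last first.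
  exists 1 => // x; have [->|x0] := eqVneq x 0; first by rewrite normr0 mulr0 is_norm0.
  by have := unit_S _ x0; rewrite S0.
have cS : compact S.
  apply: bounded_closed_compact.
    by exists 1; split => // u u1 x; rewrite /S/= => ->; exact: ltW.
  have -> : S = Num.norm @^-1` [set 1 : R] by [].
  apply: preimage_closed; last exact: closed_eq.
  by move=> x _; exact: norm_continuous.
have contN : {within S, continuous N}.
  apply: (@is_norm_lipschitz_continuous _ _ 1) => // x y _ _.
  by rewrite mul1r is_norm_sub_le.
have [x0 /[!inE] x0S x0min] := compact_EVT_min S0 cS contN.
exists (N x0).
  rewrite lt_neqAle is_norm_ge0 andbT eq_sym; apply/eqP => /(is_norm_definite normN) x00.
  by move: x0S; rewrite /S/= x00 normr0 => /esym/eqP; rewrite oner_eq0.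
move=> x; have [->|xn0] := eqVneq x 0; first by rewrite normr0 mulr0 is_norm0.
have := x0min (`|x|^-1 *: x); rewrite inE => /(_ (unit_S _ xn0)).
by rewrite (is_norm_scale normN) normfV normr_id mulrC ler_pdivlMr// normr_gt0.
Qed.

(** [sup] has a junk value on unbounded sets, so boundedness must be shown before [dual_norm] can be
    used: the unit ball of [N] has coordinates at most [c^-1]. *)
Lemma dual_norm_has_sup g : has_sup [set dot g y | y in [set y | N y <= 1]].
Proof.
split; first by exists (dot g 0), 0 => //=; rewrite is_norm0.
have [c c0 cN] := sup_le_is_norm.
exists ((\sum_i `|g 0 i|) * c^-1) => _ [y /= Ny <-].
rewrite /dot mulr_suml ler_sum// => i _.
rewrite (le_trans (ler_norm _))// normrM ler_wpM2l//.
rewrite -[leRHS]mul1r ler_pdivlMr// (le_trans _ Ny)// (le_trans _ (cN y))//.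
by rewrite mulrC ler_pM2l// coord_le_norm.
Qed.

Lemma dot_le_dual_norm g y : dot g y <= dual_norm N g * N y.
Proof.
have [->|y0] := eqVneq y 0; first by rewrite dot0r is_norm0 mulr0.
have Ny0 : 0 < N y.
  rewrite lt_neqAle is_norm_ge0 andbT eq_sym; apply/eqP => /(is_norm_definite normN).
  exact/eqP.
rewrite -ler_pdivrMr// mulrC -dotZr; apply: ub_le_sup.
  by case: (dual_norm_has_sup g).
exists ((N y)^-1 *: y) => //=.
by rewrite (is_norm_scale normN) gtr0_norm ?invr_gt0// mulVf// gt_eqF.
Qed.

Lemma dual_norm_ge0 g : 0 <= dual_norm N g.
Proof.
apply: ub_le_sup; first by case: (dual_norm_has_sup g).
by exists 0; rewrite /= ?is_norm0 ?dot0r.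
Qed.

End NormedRow.

(** * Exponential weights *)

Section ExponentialWeights.
Variable R : realType.

(** From e^x >= 1 + x, the left side is at most 1 / (1 + x), and (1 - x + x^2)(1 + x) = 1 + x^3 >=
    1. *)
Lemma expRN_le_quadratic (x : R) : 0 <= x -> expR (- x) <= 1 - x + x ^+ 2.
Proof.
move=> x0; have x1 : 0 < 1 + x by lra.
rewrite expRN; apply: (@le_trans _ _ (1 + x)^-1).
  by rewrite lef_pV2 ?posrE ?expR_gt0// expR_ge1Dx.
rewrite -[leLHS]mul1r ler_pdivrMr//.
have -> : (1 - x + x ^+ 2) * (1 + x) = 1 + x ^+ 3 by ring.
by rewrite lerDl exprn_ge0.
Qed.

(** A Hoeffding-type bound with constant 1. After a shift by [c] the exponents lie in
    [[0, eta * b]], so the quadratic bound applies with its square replaced by [(eta * b) ^+ 2]. The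
    average is then affine in the losses, and 1 + x <= e^x returns to an exponential. *)
Lemma exp_weights_normalizer (K : nat) (w l : 'I_K -> R) (eta c b : R) :
  0 <= eta -> (forall i, 0 <= w i) -> \sum_i w i = 1 ->
  (forall i, c <= l i <= c + b) ->
  \sum_i w i * expR (- eta * l i)
    <= expR (- eta * (\sum_i w i * l i) + (eta * b) ^+ 2).
Proof.
move=> eta0 w0 w1 lcb.
pose u i := eta * (l i - c).
have u0 i : 0 <= u i by rewrite mulr_ge0// subr_ge0; case/andP: (lcb i).
have ub i : u i ^+ 2 <= (eta * b) ^+ 2.
  rewrite lerXn2r ?nnegrE//; last by rewrite ler_wpM2l// lerBlDl; case/andP: (lcb i).
  by rewrite mulr_ge0//; have /andP[h1 h2] := lcb i; lra.
apply: (@le_trans _ _ (expR (- eta * c) *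
    (1 + (- eta * (\sum_i w i * l i) + eta * c + (eta * b) ^+ 2)))).
  have -> : 1 + (- eta * (\sum_i w i * l i) + eta * c + (eta * b) ^+ 2)
      = \sum_i w i * (1 - u i + (eta * b) ^+ 2).
    have -> : \sum_i w i * (1 - u i + (eta * b) ^+ 2)
        = \sum_i ((1 + eta * c + (eta * b) ^+ 2) * w i - eta * (w i * l i)).
      by apply: eq_bigr => i _; rewrite /u; ring.
    by rewrite big_split/= -mulr_sumr w1 sumrN -mulr_sumr; ring.
  rewrite mulr_sumr ler_sum// => i _; rewrite mulrCA ler_wpM2l//.
  have -> : - eta * l i = - eta * c + - u i by rewrite /u; ring.
  rewrite expRD ler_wpM2l ?expR_ge0//.
  by rewrite (le_trans (expRN_le_quadratic (u0 i)))// lerD2l.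
apply: (@le_trans _ _ (expR (- eta * c) *
    expR (- eta * (\sum_i w i * l i) + eta * c + (eta * b) ^+ 2))).
  by rewrite ler_wpM2l ?expR_ge0// expR_ge1Dx.
by rewrite -expRD ler_expR; lra.
Qed.

Variables (K T : nat) (w l : 'I_K -> nat -> R) (eta : R).
Hypothesis K_gt0 : (0 < K)%N.
Hypothesis w_init : forall i, w i 1 = K%:R^-1.
Hypothesis w_step : forall i t, (1 <= t <= T)%N ->
  w i t.+1 = w i t * expR (- eta * l i t)
             / \sum_j w j t * expR (- eta * l j t).

Lemma exp_weights_proba t : (1 <= t <= T.+1)%N ->
  (forall i, 0 < w i t) /\ \sum_i w i t = 1.
Proof.
case: t => // t; rewrite ltnS => /= tT; elim: t tT => [_|t IH tT].
  split=> [i|]; first by rewrite w_init invr_gt0 ltr0n.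
  rewrite (eq_bigr (fun=> K%:R^-1)) // sumr_const card_ord -[LHS]mulr_natr mulVf//.
  by rewrite pnatr_eq0 -lt0n.
have [w0 w1] := IH (ltnW tT).
have Z0 : 0 < \sum_j w j t.+1 * expR (- eta * l j t.+1).
  rewrite (bigD1 (Ordinal K_gt0))//= ltr_pwDl ?mulr_gt0 ?expR_gt0// sumr_ge0// => i _.
  by rewrite mulr_ge0 ?expR_ge0// ltW.
split=> [i|].
  by rewrite w_step//= divr_gt0// mulr_gt0 ?expR_gt0.
under eq_bigr do rewrite w_step//=.
by rewrite -mulr_suml divff// gt_eqF.
Qed.

Lemma exp_weights_regret (c : nat -> R) (b : R) (i : 'I_K) :
  0 <= eta ->
  (forall j t, (1 <= t <= T)%N -> c t <= l j t <= c t + b) ->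
  eta * \sum_(1 <= t < T.+1) (\sum_j w j t * l j t - l i t)
    <= ln K%:R + T%:R * (eta * b) ^+ 2.
Proof.
move=> eta0 lcb.
have K0 : 0 < K%:R :> R by rewrite ltr0n.
(* Each round multiplies the weight of [i] by e^(-eta * loss) over the normalizer, hence by at least
   e^(eta * gap - (eta * b)^2), where gap is the mean loss minus the loss of [i]. *)
have lower t : (t <= T)%N -> K%:R^-1 * expR
      (eta * \sum_(1 <= s < t.+1) (\sum_j w j s * l j s - l i s)
       - t%:R * (eta * b) ^+ 2) <= w i t.+1.
  elim: t => [_|t IH tT].
    by rewrite big_geq// mulr0 mul0r subrr expR0 mulr1 w_init.
  have [w0 w1] := @exp_weights_proba t.+1 (ltnW tT).
  rewrite w_step//.
  have Z0 : 0 < \sum_j w j t.+1 * expR (- eta * l j t.+1).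
    rewrite (bigD1 i)//= ltr_pwDl ?mulr_gt0 ?expR_gt0// sumr_ge0// => j _.
    by rewrite mulr_ge0 ?expR_ge0// ltW.
  rewrite ler_pdivlMr//.
  have := exp_weights_normalizer eta0 (fun j => ltW (w0 j)) w1 (fun j => lcb j t.+1 tT).
  set Z := (X in X <= _); set p := \sum_j _ => Zle.
  apply: le_trans (_ : K%:R^-1 * expR
      (eta * \sum_(1 <= s < t.+1) (\sum_j w j s * l j s - l i s)
       - t%:R * (eta * b) ^+ 2) * expR (- eta * l i t.+1) <= _); last first.
    by rewrite ler_wpM2r ?expR_ge0// IH// ltnW.
  apply: le_trans (ler_wpM2l _ Zle) _; first by rewrite mulr_ge0 ?expR_ge0// invr_ge0 ltW.
  rewrite -!mulrA -!expRD ler_wpM2l ?invr_ge0 ?(ltW K0)// ler_expR.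
  rewrite (big_nat_recr t.+1)//= -/p -natr1 mulrDr.
  set S := \sum_(_ <= _ < _) _; set q := (eta * b) ^+ 2; lra.
have [w0 w1] := @exp_weights_proba T.+1 (leqnn _).
(* A probability is at most 1; taking logarithms in [lower] at time [T] then yields the regret
   bound. *)
have wi1 : w i T.+1 <= 1.
  by rewrite -w1 (bigD1 i)//= lerDl sumr_ge0// => j _; exact: ltW.
have := le_trans (lower T (leqnn _)) wi1.
by rewrite mulrC ler_pdivrMr// mul1r -[in leRHS](lnK K0)// ler_expR lerBlDr.
Qed.

End ExponentialWeights.

(** * Mirror descent *)

Section Convex.
Variables (R : realType) (d : nat) (A : set 'rV[R]_d).
Implicit Types (x y z g : 'rV[R]_d).

Lemma convex_setP (s : R) x y : convex_set A -> 0 <= s <= 1 -> A x -> A y ->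
  A (s *: x + (1 - s) *: y).
Proof.
move=> cA /andP[s0 s1] Ax Ay.
by have := cA x y (Itv01 s0 s1); rewrite !inE; exact.
Qed.

Lemma convex_functionP (h : 'rV[R]_d -> R) (s : R) x y :
  convex_function A h -> 0 <= s <= 1 -> A x -> A y ->
  h (s *: x + (1 - s) *: y) <= s * h x + (1 - s) * h y.
Proof.
move=> ch /andP[s0 s1] Ax Ay.
by have := ch (Itv01 s0 s1) x y; rewrite !inE; exact.
Qed.

Lemma convex_set_sum (K : nat) (w : 'I_K -> R) (x : 'I_K -> 'rV[R]_d) :
  convex_set A -> (forall i, 0 <= w i) -> \sum_i w i = 1 ->
  (forall i, A (x i)) -> A (\sum_i w i *: x i).
Proof.
move=> cA; elim: K w x => [w x _|K IH w x w0 w1 Ax].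
  by rewrite big_ord0 => /esym/eqP; rewrite oner_eq0.
rewrite big_ord_recl; move: w1; rewrite big_ord_recl => w1.
(* If the remaining mass vanishes, so do all remaining weights; otherwise they are renormalized by
   [1 - w ord0] for the induction hypothesis. *)
have [W0|W0] := eqVneq (\sum_(i < K) w (lift ord0 i)) 0.
  rewrite big1 => [|i _].
    by move: w1; rewrite W0 !addr0 => ->; rewrite scale1r.
  by rewrite (psumr_eq0P _ W0) ?scale0r.
have W : 1 - w ord0 = \sum_(i < K) w (lift ord0 i) by rewrite -w1 addrAC subrr add0r.
rewrite -W in W0.
have -> : \sum_(i < K) w (lift ord0 i) *: x (lift ord0 i) = (1 - w ord0) *:
    \sum_(i < K) ((1 - w ord0)^-1 * w (lift ord0 i)) *: x (lift ord0 i).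
  by rewrite scaler_sumr; apply: eq_bigr => i _; rewrite scalerA mulVKf.
have W1 : 0 <= 1 - w ord0 by rewrite W sumr_ge0.
apply: convex_setP => //; first by rewrite w0/= -subr_ge0.
apply: IH => // [i|]; first by rewrite mulr_ge0// invr_ge0.
by rewrite -mulr_sumr -W mulVf.
Qed.

(** The affine minorant of [h] at the mean [m] averages to exactly [h m], because the deviations
    [x i - m] average to 0. *)
Lemma subgradient_jensen (K : nat) (h : 'rV[R]_d -> R) (g : 'rV[R]_d -> 'rV[R]_d)
    (w : 'I_K -> R) (x : 'I_K -> 'rV[R]_d) :
  convex_set A -> subgradient_on A h g ->
  (forall i, 0 <= w i) -> \sum_i w i = 1 -> (forall i, A (x i)) ->
  h (\sum_i w i *: x i) <= \sum_i w i * h (x i).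
Proof.
move=> cA hg w0 w1 Ax; set m := \sum_i w i *: x i.
have Am : A m by exact: convex_set_sum.
have -> : h m = \sum_i w i * (h m + dot (g m) (x i - m)).
  have -> : \sum_i w i * (h m + dot (g m) (x i - m)) =
      \sum_i (w i * (h m - dot (g m) m) + dot (g m) (w i *: x i)).
    by apply: eq_bigr => i _; rewrite dotBr dotZr; ring.
  rewrite big_split/= -mulr_suml w1 mul1r.
  suff <- : dot (g m) m = \sum_i dot (g m) (w i *: x i) by rewrite subrK.
  rewrite {2}/m; elim/big_ind2 : _ => //; first by rewrite dot0r.
  by move=> a b a' b' <- <-; rewrite dotDr.
by rewrite ler_sum// => i _; rewrite ler_wpM2l// hg.
Qed.

End Convex.

(** * Bregman divergences and the proximal step *)

Section MirrorDescent.
Variables (R : realType) (d : nat) (Theta : set 'rV[R]_d).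
Variables (normd psi : 'rV[R]_d -> R) (gpsi : 'rV[R]_d -> 'rV[R]_d) (sigma : R).
Hypothesis normdP : is_norm normd.
Hypothesis Theta_convex : convex_set Theta.
Hypothesis sigma_gt0 : 0 < sigma.
Hypothesis psi_C1 : C1_on Theta psi gpsi.
Hypothesis psi_sc : strongly_convex_on normd Theta sigma psi gpsi.
Implicit Types (x y z g : 'rV[R]_d).

Local Notation D := (bregman psi gpsi).

Lemma bregman_ge_sqr_norm x y : Theta x -> Theta y ->
  sigma / 2 * normd (x - y) ^+ 2 <= D x y.
Proof. by move=> /psi_sc/[apply]; rewrite /bregman; lra. Qed.

Lemma bregman_ge0 x y : Theta x -> Theta y -> 0 <= D x y.
Proof.
move=> Tx Ty; apply: le_trans (bregman_ge_sqr_norm Tx Ty).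
by rewrite mulr_ge0 ?exprn_ge0 ?is_norm_ge0 ?divr_ge0 ?ltW.
Qed.

Lemma norm_le_bregman_bound Dmax x y :
  (forall x y, Theta x -> Theta y -> D x y <= Dmax) ->
  Theta x -> Theta y -> normd (x - y) <= Num.sqrt (2 * `|Dmax| / sigma).
Proof.
move=> DM Tx Ty.
rewrite -[leLHS](@ger0_norm _ (normd _)) ?is_norm_ge0// -sqrtr_sqr ler_wsqrtr//.
rewrite ler_pdivlMr// (mulrC _ sigma).
have := le_trans (bregman_ge_sqr_norm Tx Ty) (le_trans (DM _ _ Tx Ty) (ler_norm _)).
by lra.
Qed.

(** Nonnegativity of D(y, x) bounds [psi x - psi y] by the linear term at [x]; this term and the one
    at [z] each cost [M] times the distance. *)
Lemma bregman_left_lipschitz M x y z :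
  (forall x, Theta x -> dual_norm normd (gpsi x) <= M) ->
  Theta x -> Theta y -> Theta z ->
  D x z - D y z <= 2 * M * normd (x - y).
Proof.
move=> gM Tx Ty Tz.
have := bregman_ge0 Ty Tx; rewrite /bregman => Dyx.
have h g : Theta g -> forall u, dot (gpsi g) u <= M * normd u.
  move=> Tg u; apply: le_trans (dot_le_dual_norm normdP _ _) _.
  by rewrite ler_wpM2r ?is_norm_ge0// gM.
have h1 := h _ Tx (x - y); have := h _ Tz (y - x).
rewrite -(is_normN normdP (x - y)) opprB in h1 *.
move: h1; rewrite !dotBr in Dyx *; lra.
Qed.

Section Prox.
Variables (h : 'rV[R]_d -> R) (g x x' : 'rV[R]_d).
Hypothesis Tx : Theta x.
Hypothesis h_convex : convex_function Theta h.

(* The composite objective at the point (1 - s) x' + s y is at least its value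
   at x'; dividing by s and letting s go to 0 only uses the derivative of psi
   relative to Theta. *)
Lemma prox_optimality (eta : R) y :
  0 <= eta ->
  argmin Theta (fun u => eta * dot g u + eta * h u + D u x) x' ->
  Theta y ->
  0 <= eta * dot g (y - x') + eta * (h y - h x') + dot (gpsi x' - gpsi x) (y - x').
Proof.
move=> eta0 [Tx' x'min] Ty; rewrite leNgt; apply/negP.
set c := (X in X < 0) => c0.
have n0 : 0 < `|y - x'| + 1 by rewrite ltr_wpDl.
(* This tolerance keeps the first-order error of [psi] below half of the decrease [- c], per unit of
   [s]; the [+ 1] avoids a zero denominator when [y = x']. *)
pose e := - c / 2 / (`|y - x'| + 1).
have e0 : 0 < e by rewrite !divr_gt0// oppr_gt0.
have := psi_C1.1 x' Tx' e e0; rewrite near_withinE -nbhs_ballE => -[k /= k0 hk].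
(* At most 1 so that [z] is a convex combination, and small enough that [z] is within [k / 2] of
   [x']. *)
pose s := Num.min 1 (k / 2 / (`|y - x'| + 1)).
have s0 : 0 < s by rewrite lt_min ltr01/= !divr_gt0.
have s1 : s <= 1 by rewrite ge_min lexx.
have s01 : 0 <= s <= 1 by rewrite ltW.
pose z := s *: y + (1 - s) *: x'.
have Tz : Theta z by exact: convex_setP.
have zx' : z - x' = s *: (y - x').
  by rewrite /z scalerBl scale1r scalerBr addrCA [X in X - _]addrC addrK.
have nz : `|z - x'| = s * `|y - x'| by rewrite zx' normrZ gtr0_norm.
have bz : ball x' k z.
  rewrite -ball_normE /= distrC nz.
  apply: (@le_lt_trans _ _ (k / 2)); last by lra.
  apply: (@le_trans _ _ (s * (`|y - x'| + 1))); first by rewrite ler_pM2l// lerDl.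
  by rewrite -ler_pdivlMr// ge_min lexx orbT.
have := hk z bz Tz; rewrite nz => /(le_trans (ler_norm _)) psiz.
have Fz := x'min z Tz.
have hz := convex_functionP h_convex s01 Ty Tx'; rewrite -/z in hz.
have es : e * (s * `|y - x'|) <= s * (- c / 2).
  rewrite mulrCA ler_pM2l// /e mulrAC ler_pdivrMr//.
  rewrite ler_pM2l ?lerDl//; by lra.
have gz : dot g z = dot g x' + s * dot g (y - x').
  by rewrite -dotZr -zx' -dotDr addrC subrK.
have px : dot (gpsi x) (z - x) = dot (gpsi x) (x' - x) + s * dot (gpsi x) (y - x').
  by rewrite -dotZr -zx' -dotDr; congr dot; rewrite [RHS]addrC addrA subrK.
have ehz : eta * h z <= eta * (s * h y + (1 - s) * h x') by rewrite ler_wpM2l.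
(* The objective changes by at most s * c + s * (- c / 2) = s * (c / 2) from [x'] to [z]; minimality
   makes this nonnegative, against [c < 0]. *)
suff : 0 <= s * (c / 2) by rewrite pmulr_rge0//; lra.
move: Fz; rewrite /bregman gz px.
move: psiz; rewrite zx' dotZr => psiz.
rewrite /c dotBl in es *.
move: psiz es ehz.
move: (dot g (y - x')) (dot (gpsi x) (y - x')) (dot (gpsi x') (y - x')) => a b a'.
by nra.
Qed.

(** By the three-point identity the optimality condition at [x'] reads as a bound by D(y, x) - D(y,
    x') - D(x', x). Passing from [x'] to [x] in the linear term and in [h] costs [eta * G] times the
    distance, which the strongly convex D(x', x) absorbs up to order eta^2. *)
Lemma mirror_descent_step (eta G : R) (gh : 'rV[R]_d -> 'rV[R]_d) y :
  0 < eta -> subgradient_on Theta h gh -> dual_norm normd (g + gh x) <= G ->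
  argmin Theta (fun u => eta * dot g u + eta * h u + D u x) x' ->
  Theta y ->
  dot g (x - y) + h x - h y
    <= eta^-1 * (D y x - D y x') + eta * (G ^+ 2 / (2 * sigma)).
Proof.
move=> eta0 ghP gG x'min Ty; have Tx' := x'min.1.
have opt := prox_optimality (ltW eta0) x'min Ty.
have hx := ghP x x' Tx Tx'.
have gx : dot (g + gh x) (x - x') <= G * normd (x - x').
  apply: le_trans (dot_le_dual_norm normdP _ _) _.
  by rewrite ler_wpM2r// is_norm_ge0.
have Dx := bregman_ge_sqr_norm Tx' Tx.
rewrite -(is_normN normdP (x - x')) opprB in gx.
move: (normd (x' - x)) (is_norm_ge0 normdP (x' - x)) gx Dx => u u0 gx Dx.
rewrite -(ler_pM2l eta0) [leRHS]mulrDr mulVKf ?gt_eqF//.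
(* Completing the square in [u]; the maximum is at u = eta * G / sigma. *)
have amgm : eta * (G * u) - sigma / 2 * u ^+ 2 <= eta * (eta * (G ^+ 2 / (2 * sigma))).
  rewrite -subr_ge0.
  have -> : eta * (eta * (G ^+ 2 / (2 * sigma))) - (eta * (G * u) - sigma / 2 * u ^+ 2)
    = (eta * G - sigma * u) ^+ 2 / (2 * sigma) by field; rewrite gt_eqF.
  by rewrite divr_ge0 ?sqr_ge0// mulr_ge0// ltW.
have {}gx := ler_wpM2l (ltW eta0) gx; have {}hx := ler_wpM2l (ltW eta0) hx.
move: opt gx hx Dx; rewrite /bregman !dotBl !dotDl !dotBr.
by lra.
Qed.

End Prox.
End MirrorDescent.

(** * Tracking regret *)

Section SqrtSums.
Variable R : realType.

Lemma sum_invsqrt_le (T : nat) :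
  \sum_(1 <= t < T.+1) 1 / Num.sqrt t%:R <= 2 * Num.sqrt T%:R :> R.
Proof.
elim: T => [|T IH]; first by rewrite big_geq// mulr_ge0// sqrtr_ge0.
rewrite big_nat_recr//=.
have u0 : 0 < Num.sqrt T.+1%:R :> R by rewrite sqrtr_gt0 ltr0n.
apply: (@le_trans _ _ (2 * Num.sqrt T%:R + 1 / Num.sqrt T.+1%:R)).
  by rewrite lerD2r.
rewrite -lerBrDl ler_pdivrMr//.
(* With u^2 - s^2 = 1, the inductive step 1 <= 2 * (u - s) * u is just (u - s)^2 >= 0. *)
have := @sqr_sqrtr R T%:R (ler0n _ _); have := @sqr_sqrtr R T.+1%:R (ler0n _ _).
rewrite -natr1; move: (Num.sqrt _) (Num.sqrt _) => u s us ss.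
have := sqr_ge0 (u - s); rewrite sqrrB; lra.
Qed.

(** Abel summation: the increments of the increasing factor sqrt t multiply [a t <= m] and add up to
    sqrt T * m, while the remaining differences [a t.+1 - b t] are at most [v t]. *)
Lemma sum_sqrt_telescope (T : nat) (a b v : nat -> R) (m : R) :
  (1 <= T)%N ->
  (forall t, (1 <= t <= T)%N -> a t <= m /\ 0 <= b t) ->
  (forall t, (1 <= t < T)%N -> 0 <= v t /\ a t.+1 <= b t + v t) ->
  \sum_(1 <= t < T.+1) Num.sqrt t%:R * (a t - b t)
    <= Num.sqrt T%:R * (m + \sum_(1 <= t < T) v t).
Proof.
move=> T1 ab av.
(* The last [b T] is kept on the left so that the induction can trade it for [a T.+1]. *)
suff H : \sum_(1 <= t < T.+1) Num.sqrt t%:R * (a t - b t) + Num.sqrt T%:R * b T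
    <= Num.sqrt T%:R * (m + \sum_(1 <= t < T) v t).
  apply: le_trans H; rewrite lerDl mulr_ge0// ?sqrtr_ge0//.
  by have [] := ab T; rewrite ?T1/=.
elim: T T1 ab av => // -[_ _ ab _|T IH _ ab av].
  rewrite big_nat1 big_geq// sqrtr1 !mul1r subrK addr0.
  by have [] := ab 1%N isT.
have {}IH : \sum_(1 <= t < T.+2) Num.sqrt t%:R * (a t - b t)
    + Num.sqrt T.+1%:R * b T.+1
    <= Num.sqrt T.+1%:R * (m + \sum_(1 <= t < T.+1) v t).
  by apply: IH => // t /andP[t1 tT]; [apply: ab|apply: av]; rewrite t1 leqW.
have [v0 abv] := av T.+1 (ltnSn _).
have [am _] := ab T.+2 (leqnn _).
have V0 : 0 <= \sum_(1 <= t < T.+1) v t.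
  by rewrite big_nat sumr_ge0// => t /andP[t1 tT]; have [] := av t; rewrite ?t1 //= ltnW.
rewrite big_nat_recr//= [in leRHS]big_nat_recr//=.
have su : Num.sqrt T.+1%:R <= Num.sqrt T.+2%:R :> R by rewrite ler_wsqrtr// ler_nat.
have s0 : 0 <= Num.sqrt T.+1%:R :> R by exact: sqrtr_ge0.
move: IH V0; set S := \sum_(1 <= t < T.+2) _; set V := \sum_(1 <= t < T.+1) _.
move: (Num.sqrt T.+1%:R) (Num.sqrt T.+2%:R) su s0 => s u su s0 IH V0.
have h1 : (u - s) * a T.+2 <= (u - s) * m by rewrite ler_wpM2l// subr_ge0.
have h2 : s * a T.+2 <= s * (b T.+1 + v T.+1) by rewrite ler_wpM2l.
have h3 : s * (V + v T.+1) <= u * (V + v T.+1) by rewrite ler_wpM2r// addr_ge0.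
by lra.
Qed.

End SqrtSums.

(** * Dependence of the comparator variation on the model parameter *)

Section Variation.
Variables (R : realType) (d n : nat).
Variables (normd : 'rV[R]_d -> R) (normn : 'rV[R]_n -> R).
Variables (Theta : set 'rV[R]_d) (A : set 'rV[R]_n) (T : nat) (L : R).
Variables (Phi : nat -> 'rV[R]_d -> 'rV[R]_n -> 'rV[R]_d) (theta : nat -> 'rV[R]_d).
Hypothesis normdP : is_norm normd.
Hypothesis normnP : is_norm normn.
Hypothesis L_ge0 : 0 <= L.
Hypothesis thetaP : forall t, (1 <= t <= T)%N -> Theta (theta t).
Hypothesis Phi_lip : forall t, (1 <= t <= T)%N -> forall x a b,
  Theta x -> A a -> A b -> normd (Phi t x a - Phi t x b) <= L * normn (a - b).

Lemma variation_lipschitz a b : A a -> A b ->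
  variation normd T Phi theta a
    <= variation normd T Phi theta b + T%:R * L * normn (a - b).
Proof.
move=> Aa Ab; rewrite -lerBlDl -sumrB.
apply: (@le_trans _ _ (\sum_(1 <= t < T) L * normn (a - b))).
  apply: ler_sum_nat => t /andP[t1 tT].
  have tT' : (1 <= t <= T)%N by rewrite t1 ltnW.
  apply: le_trans (ler_norm _) _; apply: le_trans (is_norm_sub_le normdP _ _) _.
  rewrite opprB addrC addrA subrK -(is_normN normnP (a - b)) opprB.
  by apply: Phi_lip => //; exact: thetaP.
rewrite sumr_const_nat -[leLHS]mulr_natl -mulrA ler_wpM2r ?mulr_ge0 ?is_norm_ge0//.
by rewrite ler_nat leq_subr.
Qed.

Lemma variation_argmin :
  closed A -> bounded_set A -> A !=set0 ->
  exists a, argmin A (variation normd T Phi theta) a.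
Proof.
move=> Acl Abd A0.
have cV : {within A, continuous (variation normd T Phi theta)}.
  apply: (is_norm_lipschitz_continuous normnP (c := T%:R * L)).
    by rewrite mulr_ge0.
  move=> a b Aa Ab; rewrite ler_norml lerBlDl variation_lipschitz// andbT.
  by rewrite lerNl opprB lerBlDl -(is_normN normnP) opprB variation_lipschitz.
have [a /[!inE] Aa amin] := compact_EVT_min A0 (bounded_closed_compact Abd Acl) cV.
by exists a; split=> // b Ab; apply: amin; rewrite inE.
Qed.

End Variation.

Section TrackingRegret.
Variables (R : realType) (d : nat) (Theta : set 'rV[R]_d).
Variables (normd psi : 'rV[R]_d -> R) (gpsi : 'rV[R]_d -> 'rV[R]_d).
Variables (sigma G M Dmax : R).
Hypothesis normdP : is_norm normd.
Hypothesis Theta_convex : convex_set Theta.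
Hypothesis sigma_gt0 : 0 < sigma.
Hypothesis psi_C1 : C1_on Theta psi gpsi.
Hypothesis psi_sc : strongly_convex_on normd Theta sigma psi gpsi.
Hypothesis gpsi_le : forall x, Theta x -> dual_norm normd (gpsi x) <= M.
Local Notation D := (bregman psi gpsi).
Hypothesis D_le : forall x y, Theta x -> Theta y -> D x y <= Dmax.

Lemma tracking_regret (T : nat) (f : nat -> 'rV[R]_d -> R) (r : 'rV[R]_d -> R)
    (gf : nat -> 'rV[R]_d -> 'rV[R]_d) (gr : 'rV[R]_d -> 'rV[R]_d)
    (Ph : nat -> 'rV[R]_d -> 'rV[R]_d) (x x' theta : nat -> 'rV[R]_d) :
  (1 <= T)%N ->
  convex_function Theta r -> subgradient_on Theta r gr ->
  (forall t, (1 <= t <= T)%N -> subgradient_on Theta (f t) (gf t)) ->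
  (forall t, (1 <= t <= T)%N -> forall y, Theta y ->
    dual_norm normd (gf t y + gr y) <= G) ->
  (forall t, (1 <= t <= T)%N -> forall y, Theta y -> Theta (Ph t y)) ->
  (forall t, (1 <= t <= T)%N -> contractive_on Theta D (Ph t)) ->
  (forall t, (1 <= t <= T)%N -> Theta (x t)) ->
  (forall t, (1 <= t <= T)%N ->
    argmin Theta (fun u => 1 / Num.sqrt t%:R * dot (gf t (x t)) u
      + 1 / Num.sqrt t%:R * r u + D u (x t)) (x' t.+1)) ->
  (forall t, (1 <= t <= T)%N -> x t.+1 = Ph t (x' t.+1)) ->
  (forall t, (1 <= t <= T)%N -> Theta (theta t)) ->
  \sum_(1 <= t < T.+1) (f t (x t) + r (x t))
    - \sum_(1 <= t < T.+1) (f t (theta t) + r (theta t))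
  <= Num.sqrt T%:R * (Dmax + G ^+ 2 / sigma
       + 2 * M * \sum_(1 <= t < T) normd (theta t.+1 - Ph t (theta t))).
Proof.
move=> T1 r_cvx grP gfP gl PhT Phc xT x'min xS thT.
have x'T t : (1 <= t <= T)%N -> Theta (x' t.+1) by move=> /x'min[].
have M0 : 0 <= M.
  apply: le_trans (gpsi_le (thT 1%N _)); [exact: dual_norm_ge0 | by rewrite T1].
pose a t := D (theta t) (x t); pose b t := D (theta t) (x' t.+1).
pose v t := 2 * M * normd (theta t.+1 - Ph t (theta t)).
rewrite -sumrB.
apply: (@le_trans _ _ (\sum_(1 <= t < T.+1)
    (Num.sqrt t%:R * (a t - b t) + (1 / Num.sqrt t%:R) * (G ^+ 2 / (2 * sigma))))).
  apply: ler_sum_nat => t /andP[t1]; rewrite ltnS => tT.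
  have h : (1 <= t <= T)%N by rewrite t1.
  have eta0 : 0 < 1 / Num.sqrt t%:R :> R by rewrite divr_gt0// sqrtr_gt0 ltr0n.
  have := mirror_descent_step normdP Theta_convex sigma_gt0 psi_C1 psi_sc
    (xT t h) r_cvx eta0 grP (gl t h _ (xT t h)) (x'min t h) (thT t h).
  rewrite -/(a t) -/(b t) div1r invrK => step.
  apply: le_trans step.
  have := gfP t h _ _ (xT t h) (thT t h).
  by rewrite !dotBr; lra.
rewrite big_split/= -mulr_suml mulrDr mulrDr.
have -> : 2 * M * \sum_(1 <= t < T) normd (theta t.+1 - Ph t (theta t))
    = \sum_(1 <= t < T) v t by rewrite mulr_sumr.
rewrite addrAC -mulrDr; apply: lerD.
  apply: sum_sqrt_telescope => // t.
    move=> h; split; first exact/D_le/xT/h/thT.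
    exact: (bregman_ge0 normdP sigma_gt0 psi_sc (thT t h) (x'T t h)).
  move=> /andP[t1 tT].
  have h : (1 <= t <= T)%N by rewrite t1 ltnW.
  have h' : (1 <= t.+1 <= T)%N by [].
  split; first by rewrite !mulr_ge0// is_norm_ge0.
  have := bregman_left_lipschitz normdP sigma_gt0 psi_sc gpsi_le
    (thT _ h') (PhT t h _ (thT t h)) (xT _ h').
  (* Contractivity compares the images of [theta t] and [x' t.+1]; the Lipschitz bound then replaces
     the image of [theta t] by [theta t.+1]. *)
  have := Phc t h _ _ (thT t h) (x'T t h); rewrite -xS// /a /b /v; lra.
apply: (@le_trans _ _ (2 * Num.sqrt T%:R * (G ^+ 2 / (2 * sigma)))).
  by rewrite ler_wpM2r ?sum_invsqrt_le// divr_ge0 ?sqr_ge0// mulr_ge0// ltW.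
by rewrite le_eqVlt; apply/orP; left; apply/eqP; field; rewrite gt_eqF.
Qed.

End TrackingRegret.

(** * Aggregation regret and the theorem *)

(** e^(-1/2) >= 1/2 gives e^(1/2) <= 2 <= N, so ln N >= 1/2 >= (1/2)^2. *)
Lemma sqrt_ln_ge_half (R : realType) (N : nat) :
  (2 <= N)%N -> 1 / 2 <= Num.sqrt (ln N%:R) :> R.
Proof.
move=> N2; rewrite -[leLHS]ger0_norm ?divr_ge0// -sqrtr_sqr ler_wsqrtr//.
have e2 : expR (1 / 2) <= 2 :> R.
  rewrite -[leLHS]invrK -expRN -[leRHS]invrK lef_pV2 ?posrE ?invr_gt0 ?expR_gt0//.
  by apply: le_trans (expR_ge1Dx _); lra.
have N0 : 0 < N%:R :> R by rewrite ltr0n (leq_trans _ N2).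
have : 1 / 2 <= ln N%:R :> R.
  by rewrite -ler_expR lnK// (le_trans e2)// ler_nat.
by lra.
Qed.

Section AggregationRegret.
Variables (R : realType) (d N T : nat) (Theta : set 'rV[R]_d).
Variables (D : 'rV[R]_d -> 'rV[R]_d -> R).
Variables (f : nat -> 'rV[R]_d -> R) (r : 'rV[R]_d -> R).
Variables (gf : nat -> 'rV[R]_d -> 'rV[R]_d) (gr : 'rV[R]_d -> 'rV[R]_d).
Variables (Phi : 'I_N -> nat -> 'rV[R]_d -> 'rV[R]_d) (eta : nat -> R) (B : R).
Variable s : dfs_trajectory R d N.
Hypothesis T_ge1 : (1 <= T)%N.
Hypothesis N_ge2 : (2 <= N)%N.
Hypothesis Theta_convex : convex_set Theta.
Hypothesis r_subgradient : subgradient_on Theta r gr.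
Hypothesis f_subgradient :
  forall t, (1 <= t <= T)%N -> subgradient_on Theta (f t) (gf t).
Hypothesis loss_gap : forall t, (1 <= t <= T)%N -> forall x y, Theta x -> Theta y ->
  f t x + r x - (f t y + r y) <= B.
Hypothesis Phi_Theta : forall i t, (1 <= t <= T)%N ->
  forall x, Theta x -> Theta (Phi i t x).
Hypothesis sP : is_dfs T Theta D f r gf Phi eta
  (Num.sqrt (2 * ln N%:R / T%:R)) 0 s.

Lemma dfs_expert_in i t : (1 <= t <= T.+1)%N -> Theta (expert s i t).
Proof.
case: t => [//|[_|t /= tT]]; first exact: (dfs_expert1 sP).
have h : (1 <= t.+1 <= T)%N by [].
by rewrite (dfs_expert sP i h); apply: (Phi_Theta i h); case: (dfs_expert_pre sP i h).
Qed.

Lemma dfs_aggregation_regret i :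
  \sum_(1 <= t < T.+1) (f t (forecast s t) + r (forecast s t))
    - \sum_(1 <= t < T.+1) (f t (expert s i t) + r (expert s i t))
  <= B + Num.sqrt T%:R * Num.sqrt (ln N%:R) * (1 + 8 * B ^+ 2).
Proof.
set q := Num.sqrt (ln N%:R); set tau := Num.sqrt T%:R.
pose eta_r : R := Num.sqrt (2 * ln N%:R / T%:R).
pose l j t := f t (expert s j t) + r (expert s j t).
have N_gt0 : (0 < N)%N by exact: leq_trans N_ge2.
have q0 : 0 < q by apply: lt_le_trans (sqrt_ln_ge_half R N_ge2); lra.
have lnN : ln N%:R = q ^+ 2.
  by rewrite sqr_sqrtr// ltW// -sqrtr_gt0.
have T0 : 0 < T%:R :> R by rewrite ltr0n.
have w_step j t : (1 <= t <= T)%N -> weight s j t.+1 =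
    weight s j t * expR (- eta_r * l j t)
      / \sum_(k < N) weight s k t * expR (- eta_r * l k t).
  move=> tT; rewrite (dfs_weight sP)// mul0r add0r subr0 mul1r.
  exact: (dfs_weight_pre sP).
have w_proba := exp_weights_proba N_gt0 (dfs_weight1 sP) w_step.
have in_le t : (1 <= t <= T)%N -> (1 <= t <= T.+1)%N.
  by case/andP=> -> h; rewrite ltnW.
(* Centring the range at the loss of expert [i] gives an interval of length [2 * B], whence the
   factor 8 in [eta2]. *)
have lb j t : (1 <= t <= T)%N -> l i t - B <= l j t <= l i t - B + 2 * B.
  move=> tT.
  have h1 := loss_gap tT (dfs_expert_in i (in_le _ tT)) (dfs_expert_in j (in_le _ tT)).
  have h2 := loss_gap tT (dfs_expert_in j (in_le _ tT)) (dfs_expert_in i (in_le _ tT)).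
  by rewrite /l; apply/andP; split; lra.
have regret := exp_weights_regret N_gt0 (dfs_weight1 sP) w_step i (sqrtr_ge0 _) lb.
(* Round 1 is split off: its forecast need not be the weighted mean, so it is compared with every
   expert at cost [B]. Jensen handles the other rounds. *)
have jensen : \sum_(1 <= t < T.+1) (f t (forecast s t) + r (forecast s t))
    <= B + \sum_(1 <= t < T.+1) \sum_j weight s j t * l j t.
  rewrite big_ltn// [in leRHS]big_ltn// addrA lerD//.
    have [w0 w1] := w_proba 1%N isT.
    rewrite -lerBlDl.
    have -> : f 1%N (forecast s 1) + r (forecast s 1) - B
        = \sum_j weight s j 1 * (f 1%N (forecast s 1) + r (forecast s 1) - B).
      by rewrite -mulr_suml w1 mul1r.
    apply: ler_sum => j _; rewrite ler_wpM2l ?(ltW (w0 _))//.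
    have := @loss_gap 1%N T_ge1 _ _ (dfs_forecast1 sP) (dfs_expert1 sP j).
    by rewrite /l; lra.
  apply: ler_sum_nat => -[//|t] /andP[t1]; rewrite ltnS => tT.
  have [w0 w1] := w_proba t.+1 (leqW tT).
  rewrite (dfs_forecast sP) ?(ltnW tT) ?andbT//.
  apply: (subgradient_jensen (g := fun x => gf t.+1 x + gr x)
    (h := fun x => f t.+1 x + r x) Theta_convex) => //.
  - move=> x y Tx Ty; rewrite dotDl addrACA lerD//; last exact: r_subgradient.
    exact: (f_subgradient (t := t.+1)).
  - by move=> j; exact: ltW.
  - by move=> j; apply: dfs_expert_in; exact: leqW tT.
(* The product is sqrt (2 ln N); the lower bound [q] suffices when the regret is divided by
   [eta_r]. *)
have eta_tau : q <= eta_r * tau.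
  rewrite /eta_r /tau -sqrtrM; last first.
    by rewrite divr_ge0 ?ler0n// lnN mulr_ge0// sqr_ge0.
  by rewrite divfK ?gt_eqF// ler_wsqrtr// lnN; have := sqr_ge0 q; lra.
have tau0 : 0 < tau by rewrite sqrtr_gt0.
have eta0 : 0 < eta_r by rewrite -(pmulr_lgt0 _ tau0); exact: lt_le_trans eta_tau.
have eta2 : T%:R * (eta_r * (2 * B)) ^+ 2 = 8 * B ^+ 2 * q ^+ 2.
  rewrite exprMn /eta_r sqr_sqrtr ?lnN; last first.
    by rewrite divr_ge0 ?ler0n// mulr_ge0// sqr_ge0.
  by field; rewrite gt_eqF.
move: regret; rewrite -/eta_r eta2 lnN sumrB => regret.
apply: le_trans (lerB jensen (lexx _)) _; rewrite -addrA lerD2l.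
rewrite -(ler_pM2l eta0); apply: le_trans regret _.
have -> : q ^+ 2 + 8 * B ^+ 2 * q ^+ 2 = q * (q * (1 + 8 * B ^+ 2)) by ring.
have -> : eta_r * (tau * q * (1 + 8 * B ^+ 2))
  = eta_r * tau * (q * (1 + 8 * B ^+ 2)) by ring.
by rewrite ler_wpM2r// mulr_ge0 ?(ltW q0)// addr_ge0// mulr_ge0// sqr_ge0.
Qed.

End AggregationRegret.

Theorem theorem4 (R : realType) (d n : nat)
    (normd : 'rV[R]_d -> R) (normn : 'rV[R]_n -> R)
    (Theta : set 'rV[R]_d) (A : set 'rV[R]_n)
    (psi : 'rV[R]_d -> R) (gpsi : 'rV[R]_d -> 'rV[R]_d)
    (sigma G M Dmax L : R) :
  is_norm normd -> is_norm normn ->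
  closed Theta -> bounded_set Theta -> convex_set Theta ->
  closed A -> bounded_set A -> convex_set A ->
  0 < sigma -> 0 < L ->
  C1_on Theta psi gpsi ->
  strongly_convex_on normd Theta sigma psi gpsi ->
  (forall x, Theta x -> dual_norm normd (gpsi x) <= M) ->
  (forall x y, Theta x -> Theta y -> bregman psi gpsi x y <= Dmax) ->
  exists2 C : R, 0 < C &
  forall (T N : nat) (eps : R)
    (f : nat -> 'rV[R]_d -> R) (r : 'rV[R]_d -> R)
    (gf : nat -> 'rV[R]_d -> 'rV[R]_d) (gr : 'rV[R]_d -> 'rV[R]_d)
    (Phi : nat -> 'rV[R]_d -> 'rV[R]_n -> 'rV[R]_d)
    (alpha : 'I_N -> 'rV[R]_n),
  (1 <= T)%N -> (2 <= N)%N -> 0 < eps ->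
  convex_function Theta r -> subgradient_on Theta r gr ->
  (forall t, (1 <= t <= T)%N ->
    [/\ convex_function Theta (f t),
        subgradient_on Theta (f t) (gf t) &
        forall x, Theta x -> dual_norm normd (gf t x + gr x) <= G]) ->
  (forall t, (1 <= t <= T)%N ->
    [/\ forall x a, Theta x -> A a -> Theta (Phi t x a),
        forall i, contractive_on Theta (bregman psi gpsi)
                    (Phi t ^~ (alpha i)) &
        forall x a b, Theta x -> A a -> A b ->
          normd (Phi t x a - Phi t x b) <= L * normn (a - b)]) ->
  injective alpha -> (forall i, A (alpha i)) ->
  (forall a, A a -> exists i, normn (a - alpha i) <= eps) ->
  forall s : dfs_trajectory R d N,
  is_dfs T Theta (bregman psi gpsi) f r gf (fun i t => Phi t ^~ (alpha i))
    (fun t => 1 / Num.sqrt t%:R) (Num.sqrt (2 * ln N%:R / T%:R)) 0 s ->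
  forall theta : nat -> 'rV[R]_d,
  (forall t, (1 <= t <= T)%N -> Theta (theta t)) ->
  exists2 a, argmin A (variation normd T Phi theta) a &
    \sum_(1 <= t < T.+1) (f t (forecast s t) + r (forecast s t))
    - \sum_(1 <= t < T.+1) (f t (theta t) + r (theta t))
    <= C * Num.sqrt T%:R *
       (Num.sqrt (ln N%:R) + variation normd T Phi theta a + T%:R * eps).
Proof.
move=> dP nP clT bT cxT clA bA cxA sigma0 L0 psiC1 psisc gM DM.
pose B := `|G| * Num.sqrt (2 * `|Dmax| / sigma).
have B0 : 0 <= B by rewrite mulr_ge0// sqrtr_ge0.
(* [1 + 8 * B ^+ 2] multiplies sqrt (ln N), [2 * |M|] the variation and [2 * (|M| * L)] the covering
   error; the other terms are additive constants, doubled because 1 <= 2 * sqrt (ln N). *)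
pose C := 1 + 8 * B ^+ 2 + 2 * B + 2 * `|Dmax| + 2 * (G ^+ 2 / sigma)
  + 2 * `|M| + 2 * (`|M| * L).
have B2 := sqr_ge0 B.
have Dm0 := normr_ge0 Dmax.
have M0 := normr_ge0 M.
have Gs0 : 0 <= G ^+ 2 / sigma by rewrite divr_ge0 ?sqr_ge0 ?ltW.
have ML0 : 0 <= `|M| * L by rewrite mulr_ge0// ltW.
exists C; first by rewrite /C; lra.
move=> T N eps f r gf gr Phi alpha T1 N2 eps0 r_cvx grP fP PhiP _ alphaA cover.
move=> s sP theta thT.
have fgP t : (1 <= t <= T)%N -> subgradient_on Theta (f t) (gf t) by case/fP.
have gl t : (1 <= t <= T)%N -> forall x, Theta x -> dual_norm normd (gf t x + gr x) <= G.
  by case/fP.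
have PhiT i t : (1 <= t <= T)%N -> forall x, Theta x -> Theta (Phi t x (alpha i)).
  by case/PhiP=> h _ _ x Tx; exact: h.
have PhiL t : (1 <= t <= T)%N -> forall x a b, Theta x -> A a -> A b ->
    normd (Phi t x a - Phi t x b) <= L * normn (a - b) by case/PhiP.
(* The subgradient inequality at [x], the dual norm bound and the diameter of [Theta]. *)
have gap t : (1 <= t <= T)%N -> forall x y, Theta x -> Theta y ->
    f t x + r x - (f t y + r y) <= B.
  move=> tT x y Tx Ty.
  apply: (@le_trans _ _ (dot (gf t x + gr x) (x - y))).
    have := fgP t tT x y Tx Ty; have := grP x y Tx Ty.
    by rewrite dotDl !dotBr; lra.
  apply: le_trans (dot_le_dual_norm dP _ _) _.
  apply: ler_pM; [exact: dual_norm_ge0|exact: is_norm_ge0| |].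
    by rewrite (le_trans (gl t tT x Tx))// ler_norm.
  exact: (norm_le_bregman_bound dP sigma0 psisc DM).
(* The first cover element witnesses that [A] is nonempty. *)
have [a aP] := variation_argmin dP nP (ltW L0) thT PhiL clA bA
  (ex_intro _ _ (alphaA (Ordinal (ltnW N2)))).
exists a => //.
have [i ai] := cover a aP.1.
have widen t : (1 <= t <= T)%N -> (1 <= t <= T.+1)%N.
  by case/andP=> t1 tT; rewrite t1 leqW.
have contr t : (1 <= t <= T)%N ->
    contractive_on Theta (bregman psi gpsi) (Phi t ^~ (alpha i)) by case/PhiP.
have agg := dfs_aggregation_regret T1 N2 cxT grP fgP gap PhiT sP i.
have track := tracking_regret dP cxT sigma0 psiC1 psisc gM DM T1 r_cvx grP fgP gl
  (PhiT i) contr (fun t tT => dfs_expert_in PhiT sP i (widen t tT))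
  (dfs_expert_pre sP i) (dfs_expert sP i) thT.
have := variation_lipschitz dP nP (ltW L0) thT PhiL (alphaA i) aP.1.
rewrite -(is_normN nP) opprB.
have V0 b : 0 <= variation normd T Phi theta b.
  by rewrite sumr_ge0// => t _; exact: is_norm_ge0.
have := V0 a; have := V0 (alpha i).
rewrite -[X in 2 * M * X]/(variation normd T Phi theta (alpha i)) in track.
move: (variation _ _ _ _ (alpha i)) (variation _ _ _ _ a) track
  => Vi Va track Vi0 Va0 Via.
have q2 := sqrt_ln_ge_half R N2.
move: agg track; set FF := \sum_(_ <= _ < _) _; set EE := \sum_(_ <= _ < _) _.
set TT := \sum_(_ <= _ < _) _ => agg track.
have tau1 : 1 <= Num.sqrt T%:R :> R by rewrite -[leLHS]sqrtr1 ler_wsqrtr// ler1n.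
have Te0 : 0 <= T%:R * eps by rewrite mulr_ge0// ltW.
have Vi_le : Vi <= Va + L * (T%:R * eps).
  apply: le_trans Via _; rewrite lerD2l mulrA [L * _]mulrC.
  by rewrite ler_wpM2l// mulr_ge0// ltW.
move: (Num.sqrt (ln _)) (Num.sqrt T%:R) q2 tau1 agg track => q tau q2 tau1 agg track.
(* A common factor sqrt T is pulled out, the additive [B] being covered by sqrt T >= 1. *)
apply: (@le_trans _ _ (tau * (B + q * (1 + 8 * B ^+ 2) + `|Dmax| + G ^+ 2 / sigma
    + 2 * (`|M| * Vi)))).
  have tau0 : 0 <= tau by lra.
  have h1 : tau * Dmax <= tau * `|Dmax| by rewrite ler_wpM2l// ler_norm.
  have h2 : tau * (M * Vi) <= tau * (`|M| * Vi).
    by rewrite ler_wpM2l// ler_wpM2r// ler_norm.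
  have h3 : B <= tau * B by rewrite ler_peMl.
  by lra.
rewrite -[leRHS]mulrA [leRHS]mulrCA ler_wpM2l//; first by lra.
have h1 : `|M| * Vi <= `|M| * Va + `|M| * L * (T%:R * eps).
  by rewrite -mulrA -mulrDr ler_wpM2l.
have one_le : 1 <= 2 * (q + Va + T%:R * eps) by lra.
have scale u : 0 <= u -> u <= 2 * u * (q + Va + T%:R * eps).
  by move=> u0; rewrite mulrAC mulrC ler_peMr// mulrC.
have sB := scale _ B0; have sD := scale _ Dm0; have sG := scale _ Gs0.
have h2 : q * (1 + 8 * B ^+ 2) <= (1 + 8 * B ^+ 2) * (q + Va + T%:R * eps).
  by rewrite mulrC ler_wpM2l; lra.
have h3 : 2 * (`|M| * Va) <= 2 * `|M| * (q + Va + T%:R * eps).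
  by rewrite mulrA ler_wpM2l; lra.
have h4 : 2 * (`|M| * L * (T%:R * eps)) <= 2 * (`|M| * L) * (q + Va + T%:R * eps).
  by rewrite mulrA ler_wpM2l; lra.
rewrite /C !mulrDl; rewrite mulrDl in h2.
by lra.
Qed.
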